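(* Let $\sigma>0$, $\sigma_A>0$, $\beta>0$. Let $(W_i)_{i\ge 1}$ be independent Brownian motions with mean $0$ and variance $\sigma^2$, and let $W_A$ be a Brownian motion with mean $0$ and variance $\sigma_A^2$, independent of $(W_i)_{i\ge1}$. Then, as $N\to\infty$, $$\frac{\max_{i\leq N}\sup_{s>0}\left(W_i(s)+W_A(s)-\beta s\right)-\frac{\sigma^2}{2\beta}\log N}{\sqrt{\log N}}\ \overset{d}{\longrightarrow}\ \frac{\sigma\sigma_A}{\sqrt{2}\,\beta}X,$$ with $X\sim\mathcal N(0,1)$. In other words, for all $x\in\mathbb R$, $$\mathbb P\left(\frac{\max_{i\leq N}\sup_{s>0}\left(W_i(s)+W_A(s)-\beta s\right)-\frac{\sigma^2}{2\beta}\log N}{\sqrt{\log N}}> x\right)\longrightarrow 1-\Phi\left(\frac{x\sqrt{2}\,\beta}{\sigma\sigma_A}\right)\quad (N\to\infty),$$ where $\Phi$ is the cumulative distribution function of a standard normal random variable.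
   Context: A Brownian motion with mean $0$ and variance $\sigma^2$ is a driftless Brownian motion $W$ started at $0$ with $\mathrm{Var}(W(t))=\sigma^2t$. $\overset{d}{\longrightarrow}$ denotes convergence in distribution. *)

(* Defs.v *)
From HB Require Import structures.
From mathcomp Require Import all_boot all_order all_algebra.
From mathcomp Require Import all_classical all_reals all_analysis.
From mathcomp Require Import measurable_realfun.
Set Implicit Arguments.
Unset Strict Implicit.
Unset Printing Implicit Defensive.
Import Order.TTheory GRing.Theory Num.Theory.
Import numFieldNormedType.Exports.
Local Open Scope classical_set_scope.
Local Open Scope ring_scope.

Section independence.
Context {d : measure_display} {T : measurableType d} {R : realType}.
Variable P : probability T R.

(* Mutual independence: the product rule over every finite subfamily. *)
Definition mutually_independent (I : choiceType) (F : I -> set (set T)) :=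
  forall (J : seq I) (A : I -> set T), uniq J ->
    (forall i, i \in J -> F i (A i)) ->
    P (\bigcap_(i in [set` J]) A i) = (\prod_(i <- J) P (A i))%E.

Definition independent2 (F G : set (set T)) :=
  forall A B, F A -> G B -> P (A `&` B) = (P A * P B)%E.

Definition sigma_RV (X : T -> R) : set (set T) :=
  preimage_set_system setT X measurable.

Definition sigma_family (K : Type) (D : set K) (X : K -> {RV P >-> R}) :
    set (set T) :=
  <<s \bigcup_(k in D) sigma_RV (X k) >>.

(* The equation is restricted to measurable sets because measures take
   unspecified values elsewhere. *)
Definition has_law (X : T -> R) (mu : set R -> \bar R) :=
  forall B : set R, measurable B -> P (X @^-1` B) = mu B.

(* A process is indexed by R but only its values at times t >= 0 matter. *)
Definition sigma_process (W : R -> {RV P >-> R}) : set (set T) :=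
  sigma_family `[0, +oo[ W.

Definition increment (W : R -> {RV P >-> R}) (s t : R) : T -> R :=
  W t \- W s.

(* Driftless Brownian motion started at 0 with Var(W(t)) = v * t. The second
   argument of normal_prob is the standard deviation. Every path is continuous,
   so that suprema over uncountable sets of times are measurable even if P is
   not complete. *)
Record brownian_motion (v : R) (W : R -> {RV P >-> R}) : Prop := {
  bm_start : {ae P, forall w, W 0 w = 0} ;
  bm_continuous : forall w, {within `[0, +oo[, continuous (fun t => W t w)} ;
  bm_independent : forall t : nat -> R, 0 <= t 0%N ->
    (forall n, t n < t n.+1) ->
    mutually_independent (fun n => sigma_RV (increment W (t n) (t n.+1))) ;
  bm_gaussian : forall s t, 0 <= s -> s < t ->
    has_law (increment W s t) (normal_prob 0 (Num.sqrt (v * (t - s)))) }.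

End independence.

Section convergence_in_distribution.
Context {d d' : measure_display} {T : measurableType d}
  {T' : measurableType d'} {R : realType}.

(* Convergence of the distribution functions at every continuity point of the
   limiting one. The Y n may take infinite values, the limit Z is real-valued. *)
Definition cvg_in_distribution (P : probability T R) (Y : nat -> T -> \bar R)
    (P' : probability T' R) (Z : T' -> R) :=
  [/\ forall n, measurable_fun setT (Y n),
      measurable_fun setT Z &
      forall x : R,
        {for x, continuous (fun r : R => P' [set w | Z w <= r])} ->
        P [set w | Y n w <= x%:E]%E @[n --> \oo] --> P' [set w | Z w <= x]].

End convergence_in_distribution.

Definition Phi {R : realType} (x : R) : \bar R := normal_prob 0 1 `]-oo, x].

Section maximum.
Context {d : measure_display} {T : measurableType d} {R : realType}.
Variable P : probability T R.

(* The maximum over the first N processes of the suprema over s > 0; the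
   processes are numbered from 0. *)
Definition max_sup (W : nat -> R -> {RV P >-> R}) (WA : R -> {RV P >-> R})
    (beta : R) (N : nat) (w : T) : \bar R :=
  \big[maxe/-oo%E]_(i < N)
    ereal_sup [set (W i s w + WA s w - beta * s)%:E | s in `]0, +oo[].

Definition normalized_max (sigma beta : R) (W : nat -> R -> {RV P >-> R})
    (WA : R -> {RV P >-> R}) (N : nat) (w : T) : \bar R :=
  ((max_sup W WA beta N w - (sigma ^+ 2 / (2 * beta) * ln N%:R)%:E)
     * ((Num.sqrt (ln N%:R))^-1)%:E)%E.

End maximum.

(* Main.v *)
Require Import Defs.
From HB Require Import structures.
From mathcomp Require Import all_boot all_order all_algebra.
From mathcomp Require Import all_classical all_reals all_analysis.
From mathcomp Require Import measurable_realfun ring lra.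
Set Implicit Arguments.
Unset Strict Implicit.
Unset Printing Implicit Defensive.
Import Order.TTheory GRing.Theory Num.Theory.
Import numFieldNormedType.Exports.
Local Open Scope classical_set_scope.
Local Open Scope ring_scope.

(** At scale [sqrt (ln N)] the only surviving randomness is that of [WA] at the
    time [t* = sigma^2 / (2 beta^2) * ln N] around which [max_(i < N) W i t - beta t]
    peaks, with value [sigma^2 / (2 beta) * ln N].  The lower bound is obtained
    by looking at time [t*] only, where the [W i t*] are independent Gaussian
    variables.  The upper bound rests on a single inequality,
    [P (exists s, W s > b + a s) <= exp (- 2 a b / v)] for a Brownian motion of
    variance [v].  It is applied to all [W i] with the two slopes [beta (1 -+ u)],
    and to [WA] with slope [beta u], forwards and backwards from [t*], so that
    the linear terms in [s - t*] cancel.  Choosing [u] of order [(ln N)^(-1/4)]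
    makes the loss, of order [u^2 ln N], a small multiple of [sqrt (ln N)], while
    the exceptional probability for [WA], of order [exp (- u sqrt (ln N))], still
    vanishes. *)

(** * Gaussian laws *)

(** The Radon-Nikodym derivative of the normal law and [normal_pdf] have the same integral over
    every measurable set. Hence they agree almost everywhere and can be exchanged under the
    integral. *)
Lemma ge0_integral_normal_prob (R : realType) (m s : R) (f : R -> \bar R) :
  measurable_fun setT f -> (forall x, 0 <= f x)%E ->
  (\int[normal_prob m s]_x f x =
   \int[lebesgue_measure]_x (f x * (normal_pdf m s x)%:E))%E.
Proof.
move=> mf f0.
have dom := normal_prob_dominates m s.
rewrite -(Radon_Nikodym_SigmaFinite.change_of_variables dom f0 measurableT mf).
apply: ae_eq_integral => //.
- apply: emeasurable_funM => //; apply: measurable_int.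
  exact: Radon_Nikodym_SigmaFinite.f_integrable.
- apply: emeasurable_funM => //; apply/measurable_EFinP.
  exact: measurable_normal_pdf.
apply: ae_eqe_mul2l; apply: integral_ae_eq => //.
- exact: Radon_Nikodym_SigmaFinite.f_integrable.
- by apply/measurable_EFinP; exact: measurable_normal_pdf.
- move=> E _ mE.
  by rewrite -(Radon_Nikodym_SigmaFinite.f_integral dom).
Qed.

(** Completing the square: tilting the density by [expR (t * x)] moves its mean to [m + t * s ^+ 2],
    and the constant left over is the value of the integral. *)
Lemma normal_mgf (R : realType) (m s t : R) : s != 0 ->
  (\int[normal_prob m s]_x (expR (t * x))%:E =
   (expR (t * m + t ^+ 2 * s ^+ 2 / 2))%:E)%E.
Proof.
move=> s0.
have mexp : measurable_fun setT (fun x : R => (expR (t * x))%:E).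
  apply/measurable_EFinP.
  apply: (measurableT_comp (@measurable_expR R)).
  exact: mulrl_measurable.
rewrite ge0_integral_normal_prob//.
transitivity (\int[lebesgue_measure]_x ((expR (t * m + t ^+ 2 * s ^+ 2 / 2))%:E *
    (normal_pdf (m + t * s ^+ 2) s x)%:E))%E.
  apply: eq_integral => x _.
  rewrite !normal_pdfE// -!EFinM /normal_fun mulrCA -expRD mulrCA -expRD.
  congr (_ * expR _)%:E.
  by field.
rewrite ge0_integralZl.
- by rewrite integral_normal_pdf mule1.
- exact: measurableT.
- by apply/measurable_EFinP; exact: measurable_normal_pdf.
- by move=> x _; rewrite lee_fin normal_pdf_ge0.
- by rewrite lee_fin expR_ge0.
Qed.

(** To the right of the mean the density decreases, so on []a, b]] it is smallest at [b]. *)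
Lemma normal_prob_itv_ge (R : realType) (s a b : R) : 0 < s -> 0 <= a -> a <= b ->
  (((b - a) * normal_pdf 0 s b)%:E <= normal_prob 0 s `]a, b])%E.
Proof.
move=> s0 a0 ab.
have sN0 : s != 0 by rewrite gt_eqF.
have -> : ((b - a) * normal_pdf 0 s b)%:E =
   (\int[lebesgue_measure]_(x in `]a, b]) (normal_pdf 0 s b)%:E)%E.
  rewrite integral_cst//= lebesgue_measure_itv /= lte_fin.
  move: ab; rewrite le_eqVlt => /predU1P[->|ab].
    by rewrite ltxx subrr mul0r mule0.
  by rewrite ab -EFinB -EFinM mulrC.
apply: ge0_le_integral => //=.
- by move=> x _; rewrite lee_fin normal_pdf_ge0.
- by apply/measurable_EFinP/measurable_funTS; exact: measurable_normal_pdf.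
- move=> x; rewrite in_itv/= => /andP[ax xb].
  rewrite lee_fin !normal_pdfE// ler_wpM2l ?normal_peak_ge0// ler_expR !subr0.
  rewrite ler_pM2r; last by rewrite invr_gt0 pmulrn_lgt0// exprn_gt0.
  have ? := le_lt_trans a0 ax.
  by rewrite lerN2 ler_pXn2r// nnegrE ltW//; apply: lt_le_trans xb.
Qed.

Lemma normal_prob_itv_le (R : realType) (m s a b : R) : s != 0 -> a <= b ->
  (normal_prob m s `]a, b] <= ((b - a) * normal_peak s)%:E)%E.
Proof.
move=> s0 ab.
have -> : ((b - a) * normal_peak s)%:E =
   (\int[lebesgue_measure]_(x in `]a, b]) (normal_peak s)%:E)%E.
  rewrite integral_cst//= lebesgue_measure_itv /= lte_fin.
  move: ab; rewrite le_eqVlt => /predU1P[->|ab].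
    by rewrite ltxx subrr mul0r mule0.
  by rewrite ab -EFinB -EFinM mulrC.
apply: ge0_le_integral => //=.
- by move=> x _; rewrite lee_fin normal_pdf_ge0.
- by apply/measurable_EFinP/measurable_funTS; exact: measurable_normal_pdf.
- by move=> x _; rewrite lee_fin normal_pdf_ub.
Qed.

(** The density is bounded by its peak. This will absorb shifts of the threshold by a small
    [delta]. *)
Lemma Phi_lipschitz (R : realType) (a b : R) : a <= b ->
  (Phi b <= Phi a + ((b - a) * normal_peak 1)%:E)%E.
Proof.
move=> ab; rewrite /Phi.
rewrite (@itv_bndbnd_setU _ _ -oo%O (BRight a) (BRight b))//.
rewrite measureU//=; last first.
  rewrite -subset0 => y []/=; rewrite !in_itv/= => ya /andP[].
  by rewrite ltNge ya.
by rewrite leeD2l// normal_prob_itv_le ?oner_eq0.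
Qed.

Lemma normal_prob_Phi (R : realType) (s x : R) : 0 < s ->
  normal_prob 0 s `]-oo, x] = Phi (x / s).
Proof.
move=> s0; have sN0 : s != 0 by rewrite gt_eqF.
pose F (y : R) := y / s.
have dF y : derivable F y 1 by [].
have F'E : F^`()%classic = cst s^-1.
  apply/funext => y.
  by rewrite derive1E deriveM// derive_cst scaler0 add0r derive_id/= [LHS]mulr1.
rewrite /Phi {2}/normal_prob.
rewrite (increasing_ge0_integration_by_substitutionNy (F := F) (G := normal_pdf 0 1)).
- apply: eq_integral => y _; rewrite F'E /= !normal_pdfE ?oner_eq0//.
  congr _%:E; rewrite !fctE /normal_fun /normal_peak !subr0 /F.
  have -> : s ^+ 2 * pi *+ 2 = s ^+ 2 * (1 ^+ 2 * pi *+ 2).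
    by rewrite expr1n mul1r mulrnAr.
  rewrite sqrtrM ?sqr_ge0// sqrtr_sqr gtr0_norm// invfM.
  rewrite [RHS]mulrC mulrA; congr (_ * expR _).
  by field.
- by move=> y z _ _ yz; rewrite ltr_pM2r// invr_gt0.
- by rewrite F'E => y _; exact: cvg_cst.
- by rewrite F'E; exact: is_cvg_cst.
- by rewrite F'E; exact: cvg_cst.
- split; first by move=> y _; exact: dF.
  apply: cvg_at_left_filter.
  exact/differentiable_continuous/derivable1_diffP/dF.
- by apply/gt0_cvgMlNy; rewrite ?invr_gt0//; exact: cvg_id.
- by apply: continuous_subspaceT => y; apply: continuous_normal_pdf; rewrite oner_eq0.
- by move=> y _; rewrite normal_pdf_ge0.
Qed.

(** * Maximal inequality for sums of independent variables *)

(** Rectangles form a pi-system generating the product sigma-algebra, and the sets [E] obeying the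
    product rule form a Dynkin system. The lemma is applied to events on the sum of [Y] and [Z]. *)
Lemma pair_indep_ext (R : realType) (d : measure_display) (T : measurableType d)
    (P : probability T R) (C : set T) (Y Z : T -> R) :
  measurable C -> measurable_fun setT Y -> measurable_fun setT Z ->
  (forall A B, measurable A -> measurable B ->
    P (C `&` (Y @^-1` A `&` Z @^-1` B)) = (P C * P (Y @^-1` A `&` Z @^-1` B))%E) ->
  forall E, measurable E ->
    P (C `&` (fun w => (Y w, Z w)) @^-1` E) =
    (P C * P ((fun w => (Y w, Z w)) @^-1` E))%E.
Proof.
move=> mC mY mZ CYZ.
have mYZ : measurable_fun setT (fun w => (Y w, Z w)) by exact: measurable_fun_pair.
have mpre E : measurable E -> measurable ((fun w => (Y w, Z w)) @^-1` E).
  by move=> mE; rewrite -[X in measurable X]setTI; exact: mYZ.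
move=> E; rewrite {1}measurable_prod_measurableType.
apply: (dynkin_induction (G := [set A `*` B | A in measurable & B in measurable])
  (P := fun E => P (C `&` (fun w => (Y w, Z w)) @^-1` E) =
    (P C * P ((fun w => (Y w, Z w)) @^-1` E))%E)).
- exact: measurable_prod_measurableType.
- move=> _ _ [A1 mA1] [B1 mB1] <- [A2 mA2] [B2 mB2] <-.
  rewrite -setXI; exists (A1 `&` A2); first exact: measurableI.
  by exists (B1 `&` B2) => //; exact: measurableI.
- by rewrite preimage_setT setIT probability_setT mule1.
- move=> _ [A mA] [B mB] <-.
  exact: CYZ.
- move=> S mS; move/mpre : mS => mS PS.
  change (P (C `&` ~` ((fun w => (Y w, Z w)) @^-1` S)) =
    (P C * P (~` ((fun w => (Y w, Z w)) @^-1` S)))%E).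
  move: mS PS; set Q := _ @^-1` S => mQ PQ.
  have := @measureD _ _ _ P _ _ mC mQ; rewrite setDE => ->; last first.
    by rewrite ltey_eq fin_num_measure.
  transitivity (P C - P C * P Q)%E; first by congr (_ - _)%E; exact: PQ.
  by rewrite probability_setC// muleBr ?fin_num_measure ?mule1.
- move=> F mF tF PF.
  have tYZF : trivIset setT (fun k => (fun w => (Y w, Z w)) @^-1` F k).
    by move=> i j _ _ [w [Fi Fj]]; apply: tF => //; exists (Y w, Z w).
  rewrite preimage_bigcup setI_bigcupr.
  rewrite measure_bigcup//=; last 2 first.
  + by move=> i _; apply: measurableI => //; exact: mpre.
  + by exact: trivIset_setIl.
  rewrite measure_bigcup//=; last by move=> i _; exact: mpre.
  rewrite -(fineK (fin_num_measure P C mC)) -nneseriesZl//.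
  apply: eq_eseriesr => i _.
  by rewrite PF fineK ?fin_num_measure.
Qed.

Lemma mutually_independent_preimage (R : realType) (d : measure_display)
    (T : measurableType d) (P : probability T R) (I : choiceType)
    (X : I -> T -> R) :
  mutually_independent P (fun i => sigma_RV (X i)) ->
  forall J A, uniq J -> (forall i, measurable (A i)) ->
  P (\bigcap_(i in [set` J]) X i @^-1` A i) = (\prod_(i <- J) P (X i @^-1` A i))%E.
Proof.
move=> Xind J A uJ mA; apply: Xind => // i _.
by exists (A i) => //; rewrite setTI.
Qed.

(* The largest sum of a prefix of [J], the empty one included; the recursion adds
   one independent term at a time, hence no martingale theory is needed. *)
Definition lindley {R : realType} {T I : Type} (X : I -> T -> R) (J : seq I)
    (w : T) : R :=
  foldr (fun j v => Num.max 0 (X j w + v)) 0 J.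

Lemma measurable_lindley (R : realType) (d : measure_display)
    (T : measurableType d) (I : Type) (X : I -> T -> R) (J : seq I) :
  (forall i, measurable_fun setT (X i)) -> measurable_fun setT (lindley X J).
Proof.
move=> mX; elim: J => [|j J IH]; first exact: measurable_cst.
by apply: measurable_maxr => //; exact: measurable_funD.
Qed.

(** At each entry of [J] the maximum dominates its second argument, which adds the next term; what
    remains after [J] is nonnegative. *)
Lemma sum_le_lindley (R : realType) (T I : Type) (X : I -> T -> R)
    (J K : seq I) (w : T) :
  \sum_(j <- J) X j w <= lindley X (J ++ K) w.
Proof.
elim: J => [|j J IH] /=.
  by rewrite big_nil; case: K => //= k K; rewrite le_max lexx.
by rewrite big_cons le_max lerD2l IH orbT.
Qed.

Section lindley_independence.
Context (R : realType) (d : measure_display) (T : measurableType d)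
  (P : probability T R) (I : choiceType) (X : I -> T -> R).
Hypothesis mX : forall i, measurable_fun setT (X i).
Hypothesis Xind : mutually_independent P (fun i => sigma_RV (X i)).

Let mpre (Y : T -> R) B : measurable_fun setT Y -> measurable B ->
  measurable (Y @^-1` B).
Proof. by move=> mY mB; rewrite -[X in measurable X]setTI; exact: mY. Qed.

(** The list [K] is there for the induction on [J]. By [pair_indep_ext] only rectangles in [X j] and
    [lindley X J] matter, and on these the constraint on the head [j] moves from [J] to [K]. *)
Lemma lindley_indep (J K : seq I) (A : I -> set R) (B : set R) :
  uniq (K ++ J) -> (forall i, measurable (A i)) -> measurable B ->
  P ((\bigcap_(i in [set` K]) X i @^-1` A i) `&` lindley X J @^-1` B) =
  (P (\bigcap_(i in [set` K]) X i @^-1` A i) * P (lindley X J @^-1` B))%E.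
Proof.
elim: J K A B => [|j J IH] K A B uKJ mA mB.
  have [B0|B0] := pselect (B 0).
    rewrite (_ : lindley X [::] @^-1` B = setT); last by apply/seteqP; split.
    by rewrite setIT probability_setT mule1.
  rewrite (_ : lindley X [::] @^-1` B = set0); last by apply/seteqP; split.
  by rewrite setI0 measure0 mule0.
have mV := @measurable_lindley _ _ _ _ X J mX.
have mC (L : seq I) : measurable (\bigcap_(i in [set` L]) X i @^-1` A i).
  by apply: (fin_bigcap_measurable (finite_seq L)) => i _; exact: mpre.
have ujJ : uniq ([:: j] ++ J) by move: uKJ; rewrite cat_uniq => /and3P[].
have uK : uniq K by move: uKJ; rewrite cat_uniq => /and3P[].
have jK : j \notin K.
  move: uKJ; rewrite cat_uniq => /and3P[_ + _].
  by rewrite /= negb_or => /andP[].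
have ujKJ : uniq ((j :: K) ++ J).
  by move: uKJ; rewrite -(@perm_uniq _ (j :: K ++ J))//; rewrite -cat1s perm_catCA.
pose g (p : R * R) := Num.max 0 (p.1 + p.2).
have mg : measurable_fun setT g.
  apply: measurable_maxr => //; apply: measurable_funD.
    exact: measurable_fst.
  exact: measurable_snd.
have -> : lindley X (j :: J) @^-1` B =
  (fun w => (X j w, lindley X J w)) @^-1` (g @^-1` B) by [].
apply: pair_indep_ext => //; last by rewrite -[X in measurable X]setTI; exact: mg.
move=> A1 B1 mA1 mB1.
(* Since [j] is not in [K], changing the constraint at [j] leaves the intersection over [K] as it
   was. *)
pose A' i := if i == j then A1 else A i.
have mA' i : measurable (A' i) by rewrite /A'; case: ifP.
have A'K : \bigcap_(i in [set` K]) X i @^-1` A' i =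
           \bigcap_(i in [set` K]) X i @^-1` A i.
  apply: eq_bigcapr => i /= iK; rewrite /A'; case: eqP => // ij.
  by rewrite -ij iK in jK.
have A'jK : \bigcap_(i in [set` j :: K]) X i @^-1` A' i =
    (\bigcap_(i in [set` K]) X i @^-1` A i) `&` X j @^-1` A1.
  rewrite (_ : [set` j :: K] = j |` [set` K]); last first.
    apply/seteqP; split => i /=; rewrite inE.
      by move=> /orP[/eqP->|iK]; [left|right].
    by move=> [->|->]; rewrite ?eqxx ?orbT.
  rewrite bigcap_setU1 A'K setIC; congr (_ `&` _).
  by rewrite /A' eqxx.
have A'j : \bigcap_(i in [set` [:: j]]) X i @^-1` A' i = X j @^-1` A1.
  by rewrite set_cons1 bigcap_set1 /A' eqxx.
have jV : P (X j @^-1` A1 `&` lindley X J @^-1` B1) =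
    (P (X j @^-1` A1) * P (lindley X J @^-1` B1))%E.
  by rewrite -A'j IH.
rewrite setIA -A'jK IH// jV.
rewrite (mutually_independent_preimage Xind (J := j :: K))//=; last first.
  by rewrite jK.
rewrite big_cons -(mutually_independent_preimage Xind (J := K))// A'K.
by rewrite /A' eqxx muleCA muleA.
Qed.

End lindley_independence.

(** Integrating over the value [x] of [X], the tail bound of [V] at [b - x] gives
    [expR (- (t * b)) * expR (t * x)], whose mean is controlled by the exponential moment of [X]. *)
Lemma indep_sum_tail (R : realType) (d : measure_display) (T : measurableType d)
    (P : probability T R) (X V : {RV P >-> R}) (t b : R) :
  (forall A B, measurable A -> measurable B ->
    P (X @^-1` A `&` V @^-1` B) = (P (X @^-1` A) * P (V @^-1` B))%E) ->
  (\int[P]_w (expR (t * X w))%:E <= 1)%E ->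
  (forall c, (P [set w | (c < V w)%R] <= (expR (- (t * c)))%:E)%E) ->
  (P [set w | (b < X w + V w)%R] <= (expR (- (t * b)))%:E)%E.
Proof.
move=> XV tX tV.
have mXV : measurable_fun setT (fun w => (X w, V w)) by exact: measurable_fun_pair.
pose XVmix := isMeasurableFun.Build _ _ _ _ _ mXV.
pose XVp : {mfun T >-> (R * R)%type} := HB.pack (fun w => (X w, V w)) XVmix.
pose E := [set p : R * R | b < p.1 + p.2].
have mE : measurable E.
  have mg : measurable_fun setT (fun p : R * R => p.1 + p.2).
    by apply: measurable_funD; [exact: measurable_fst|exact: measurable_snd].
  rewrite (_ : E = (fun p : R * R => p.1 + p.2) @^-1` `]b, +oo[); last first.
    by apply/seteqP; split => p /=; rewrite /E/= in_itv/= andbT.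
  by rewrite -[X in measurable X]setTI; exact: mg.
have -> : P [set w | (b < X w + V w)%R] = distribution P XVp E by [].
(* By independence on rectangles the joint law is the product of the two laws, so the event is
   measured section by section. *)
rewrite -(@product_measure_unique _ _ _ _ _ (distribution P X) (distribution P V))//.
rewrite /= /product_measure1.
apply: (@le_trans _ _ (\int[distribution P X]_x (expR (- (t * b)) * expR (t * x))%:E)%E).
  apply: ge0_le_integral => //.
  - exact: measurable_fun_xsection.
  - apply/measurable_EFinP; apply: measurable_funM => //.
    apply: (measurableT_comp (@measurable_expR R)).
    exact: mulrl_measurable.
  - move=> x _; rewrite -expRD.
    rewrite (_ : - (t * b) + t * x = - (t * (b - x))); last by ring.
    apply: le_trans (tV (b - x)).
    rewrite le_eqVlt; apply/orP; left; apply/eqP; congr (P _).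
    by apply/seteqP; split => w /=; rewrite /xsection/= inE /E/= ltrBlDl.
have mexp : measurable_fun setT (fun x : R => (expR (t * x))%:E).
  apply/measurable_EFinP.
  apply: (measurableT_comp (@measurable_expR R)).
  exact: mulrl_measurable.
under eq_integral do rewrite EFinM.
rewrite ge0_integralZl//.
rewrite ge0_integral_distribution//.
by rewrite -[leRHS]mule1 lee_wpmul2l// ?lee_fin ?expR_ge0.
Qed.

(** This plays the role of the maximal inequality for the exponential supermartingale. For [c < 0]
    the bound is at least 1; for [0 <= c] the truncation at 0 does not affect the event, and
    [indep_sum_tail] carries the bound from [J] to [j :: J]. *)
Lemma lindley_tail (R : realType) (d : measure_display) (T : measurableType d)
    (P : probability T R) (I : choiceType) (X : I -> T -> R) (t : R) :
  0 <= t -> (forall i, measurable_fun setT (X i)) ->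
  mutually_independent P (fun i => sigma_RV (X i)) ->
  (forall i, (\int[P]_w (expR (t * X i w))%:E <= 1)%E) ->
  forall (J : seq I) (c : R), uniq J ->
  (P [set w | (c < lindley X J w)%R] <= (expR (- (t * c)))%:E)%E.
Proof.
move=> t0 mX Xind tX; elim => [|j J IH] c uJ.
  rewrite /lindley/=; have [c0|c0] := ltP c 0.
    apply: (le_trans (probability_le1 _ _)).
      by rewrite (_ : [set _ | _] = setT)//; apply/seteqP; split.
    by rewrite lee_fin -expR0 ler_expR oppr_ge0 mulr_ge0_le0// ltW.
  rewrite (_ : [set _ | _] = set0); last first.
    by apply/seteqP; split => // w /=.
  by rewrite measure0 lee_fin expR_ge0.
pose Xmix := isMeasurableFun.Build _ _ _ _ _ (mX j).
pose Xp : {RV P >-> R} := HB.pack (X j) Xmix.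
pose Vmix := isMeasurableFun.Build _ _ _ _ _ (@measurable_lindley _ _ _ _ X J mX).
pose Vp : {RV P >-> R} := HB.pack (lindley X J) Vmix.
have mV := @measurable_lindley _ _ _ _ X (j :: J) mX.
have [c0|c0] := ltP c 0.
  apply: (le_trans (probability_le1 _ _)).
    rewrite (_ : [set _ | _] = lindley X (j :: J) @^-1` `]c, +oo[).
      by rewrite -[X in measurable X]setTI; exact: mV.
    by apply/seteqP; split => w /=; rewrite in_itv/= andbT.
  by rewrite lee_fin -expR0 ler_expR oppr_ge0 mulr_ge0_le0// ltW.
rewrite (_ : [set _ | _] = [set w | c < Xp w + Vp w]); last first.
  by apply/seteqP; split => w /=; rewrite lt_max ltNge c0.
move: uJ => /= /andP[jJ uJ].
apply: (@indep_sum_tail _ _ _ P Xp Vp t c) => //.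
- move=> A B mA mB.
  have := @lindley_indep _ _ _ P I X mX Xind J [:: j] (fun=> A) B.
  by rewrite set_cons1 bigcap_set1 /= jJ uJ; apply.
- exact: tX.
- by move=> c'; exact: IH.
Qed.

(** * Brownian motion crossing a line *)

(* The exceptional set is only a superset of the event that [Q] fails, which need
   not be measurable. *)
Definition holds_upto {d : measure_display} {T : measurableType d} {R : realType}
    (P : probability T R) (c : R) (Q : T -> Prop) :=
  exists E, [/\ measurable E, (P E <= c%:E)%E & forall w, ~ E w -> Q w].

Section holds_upto.
Context (d : measure_display) (T : measurableType d) (R : realType)
  (P : probability T R).
Implicit Types (c : R) (Q : T -> Prop).

Lemma holds_uptoS c1 c2 Q1 Q2 : c1 <= c2 -> (forall w, Q1 w -> Q2 w) ->
  holds_upto P c1 Q1 -> holds_upto P c2 Q2.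
Proof.
move=> c12 Q12 [E [mE PE HE]]; exists E; split => //.
- by apply: (le_trans PE); rewrite lee_fin.
- by move=> w /HE; exact: Q12.
Qed.

Lemma holds_upto_and c1 c2 Q1 Q2 : holds_upto P c1 Q1 -> holds_upto P c2 Q2 ->
  holds_upto P (c1 + c2) (fun w => Q1 w /\ Q2 w).
Proof.
move=> [E1 [mE1 PE1 HE1]] [E2 [mE2 PE2 HE2]]; exists (E1 `|` E2); split.
- exact: measurableU.
- by rewrite EFinD; apply: (le_trans (measureU2 _ _ _)) => //; exact: leeD.
- by move=> w /not_orP[/HE1 ? /HE2 ?].
Qed.

Lemma holds_upto_all c (Q : nat -> T -> Prop) (N : nat) :
  (forall i, holds_upto P c (Q i)) ->
  holds_upto P (N%:R * c) (fun w => forall i, (i < N)%N -> Q i w).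
Proof.
move=> HQ; elim: N => [|N IH].
  by exists set0; split => //; rewrite measure0 mul0r.
have := holds_upto_and IH (HQ N); apply: holds_uptoS.
  by rewrite -natr1 mulrDl mul1r.
by move=> w [Hlt HN] i; rewrite ltnS leq_eqVlt => /predU1P[->|/Hlt].
Qed.

Lemma holds_upto_ae Q : {ae P, forall w, Q w} -> holds_upto P 0 Q.
Proof.
move=> [E [mE PE HE]]; exists E; split => //; first by rewrite PE.
by move=> w Ew; apply: contrapT => Qw; exact/Ew/HE.
Qed.

End holds_upto.

(** [F] is the lower limit of the [E n], an increasing union of intersections each of measure at
    most [c]. Outside [F] infinitely many of the [E m] fail, which suffices to let a mesh tend to 0
    or a horizon to infinity. *)
Lemma liminf_measure_le (R : realType) (d : measure_display) (T : measurableType d)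
    (P : probability T R) (E : nat -> set T) (c : \bar R) :
  (forall n, measurable (E n)) -> (forall n, (P (E n) <= c)%E) ->
  exists F, [/\ measurable F, (P F <= c)%E &
    forall w, ~ F w -> forall n, exists2 m, (n <= m)%N & ~ E m w].
Proof.
move=> mE Ec.
pose G n := \bigcap_(k in [set k | (n <= k)%N]) E k.
have mG n : measurable (G n) by apply: bigcap_measurableType => k _.
have mF : measurable (\bigcup_n G n) by exact: bigcupT_measurable.
exists (\bigcup_n G n); split => //.
  have ndG : nondecreasing_seq G.
    by move=> m n mn; apply/subsetPset => w Gw k /= nk; apply: Gw => /=; exact: leq_trans nk.
  have cv := nondecreasing_cvg_mu mG mF ndG (mu := P).
  rewrite -(cvg_lim _ cv)//; apply: lime_le; first by apply/cvg_ex; eexists; exact: cv.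
  apply: nearW => n /=; apply: (le_trans _ (Ec n)); apply: le_measure; rewrite ?inE//.
  by move=> w; apply => /=.
move=> w Fw n; apply: contrapT => H; apply: Fw; exists n => // k /= nk.
by apply: contrapT => Ek; apply: H; exists k.
Qed.

Lemma mutually_independentS (R : realType) (d : measure_display)
    (T : measurableType d) (P : probability T R) (I : choiceType)
    (F G : I -> set (set T)) :
  (forall i, F i `<=` G i) -> mutually_independent P G -> mutually_independent P F.
Proof. by move=> FG iG J A uJ FA; apply: iG => // i iJ; exact/FG/FA. Qed.

Lemma ge0_has_law_integral (R : realType) (d : measure_display)
    (T : measurableType d) (P : probability T R) (X : T -> R)
    (mu : {measure set (measurableTypeR R) -> \bar R}) (f : R -> \bar R) :
  measurable_fun setT X -> has_law P X mu ->
  measurable_fun setT f -> (forall x, 0 <= f x)%E ->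
  (\int[P]_w f (X w) = \int[mu]_x f x)%E.
Proof.
move=> mX Xmu mf f0.
have mX' : measurable_fun setT (X : T -> measurableTypeR R) by [].
pose Xmix := isMeasurableFun.Build _ _ _ _ _ mX'.
pose Y : {RV P >-> measurableTypeR R} := HB.pack (X : T -> measurableTypeR R) Xmix.
transitivity (\int[distribution P Y]_x f x)%E.
  by rewrite ge0_integral_distribution.
by apply: eq_measure_integral => A mA _; exact: Xmu.
Qed.

(** If [g] exceeded the line at [s], by continuity it would still exceed it at the nearest point to
    the left of [s] on any fine enough grid. Arbitrarily fine grids are enough; they need not be
    nested. *)
Lemma affine_bound_grid (R : realType) (g : R -> R) (t0 h K c : R) :
  0 <= t0 -> 0 < h -> {within `[0, +oo[, continuous g} ->
  (forall n, exists2 m, (n <= m)%N & forall k, (k <= m.+1)%N ->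
     g (t0 + k%:R * (h / m.+1%:R)) <= K + c * (t0 + k%:R * (h / m.+1%:R))) ->
  forall s, t0 <= s -> s <= t0 + h -> g s <= K + c * s.
Proof.
move=> t00 h0 /subspace_continuousP cg grid s t0s sh.
rewrite leNgt; apply/negP => gs.
pose e := g s - (K + c * s).
have e0 : 0 < e by rewrite subr_gt0.
have s0 : 0 <= s by exact: le_trans t0s.
have /cvgrPdist_lt/(_ (e / 2)) : g @ within `[0, +oo[ (nbhs s) --> g s.
  by apply: cg; rewrite /= in_itv/= s0.
rewrite divr_gt0// => /(_ isT); rewrite /within/= => -[dl /= dl0 near_s].
(* Within [eta] of [s], both [g] and the line of slope [c] vary by less than [e / 2]. *)
pose eta := Num.min dl (e / (2 * (`|c| + 1))).
have c10 : 0 < `|c| + 1 by rewrite ltr_wpDl.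
have eta0 : 0 < eta by rewrite lt_min dl0/= divr_gt0// mulr_gt0.
have [m nm Hm] := grid (Num.truncn (h / eta)).
have m0 : (0 : R) < m.+1%:R by rewrite ltr0n.
pose st := h / m.+1%:R.
have st0 : 0 < st by rewrite divr_gt0.
have steta : st < eta.
  rewrite /st ltr_pdivrMr// mulrC -ltr_pdivrMr//.
  apply: lt_le_trans (_ : (Num.truncn (h / eta)).+1%:R <= _); last by rewrite ler_nat.
  by have /andP[] := truncn_itv (divr_ge0 (ltW h0) (ltW eta0)).
(* The last grid point not after [s]; it lies in [[t0, s]], hence where [g] is known to be
   continuous. *)
pose k := Num.truncn ((s - t0) / st).
have /andP[k1 k2] : k%:R <= (s - t0) / st < k.+1%:R.
  by apply: truncn_itv; rewrite divr_ge0 ?subr_ge0// ltW.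
have ks1 : k%:R * st <= s - t0 by rewrite -ler_pdivlMr.
have ks2 : s - t0 < k%:R * st + st.
  by move: k2; rewrite ltr_pdivrMr// -natr1 mulrDl mul1r.
have km : (k <= m.+1)%N.
  rewrite -(ler_nat R) -(ler_pM2r st0); apply: (le_trans ks1).
  rewrite /st mulrCA divff ?gt_eqF// mulr1; lra.
have := Hm k km; rewrite -/st; apply/negP; rewrite -ltNge.
pose y := t0 + k%:R * st; rewrite -/y.
have ks0 : 0 <= k%:R * st by rewrite mulr_ge0// ltW.
have sy : `|s - y| < eta.
  rewrite ger0_norm; last by rewrite /y; lra.
  by apply: lt_trans steta; rewrite /y; lra.
have gy : `|g s - g y| < e / 2.
  apply: near_s => /=; last by rewrite in_itv/= andbT /y; lra.
  by apply: lt_le_trans sy _; rewrite ge_min lexx.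
have cy : c * (y - s) < e / 2.
  apply: (le_lt_trans (ler_norm _)); rewrite normrM distrC.
  apply: (@le_lt_trans _ _ ((`|c| + 1) * `|s - y|)).
    by rewrite ler_wpM2r// lerDl.
  rewrite mulrC -ltr_pdivlMr// -mulrA -invfM.
  apply: (lt_le_trans sy); by rewrite ge_min lexx orbT.
move: gy; rewrite ltr_norml => /andP[_ gy].
by rewrite /e in gy cy; lra.
Qed.

Section line_crossing.
Context (R : realType) (d : measure_display) (T : measurableType d)
  (P : probability T R) (v : R) (W : R -> {RV P >-> R}).
Hypothesis v_gt0 : 0 < v.
Hypothesis W_bm : brownian_motion v W.
Variables (a t0 h : R).
Hypotheses (a_gt0 : 0 < a) (t0_ge0 : 0 <= t0) (h_gt0 : 0 < h).

Let step (n : nat) : R := h / n.+1%:R.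
Let grid (n k : nat) : R := t0 + k%:R * step n.

Let step_gt0 n : 0 < step n. Proof. by rewrite divr_gt0// ltr0n. Qed.

Let gridS n k : grid n k.+1 - grid n k = step n.
Proof. by rewrite /grid -natr1; ring. Qed.

Let grid_lt n k : grid n k < grid n k.+1.
Proof. by rewrite -subr_gt0 gridS. Qed.

Let grid_ge0 n k : 0 <= grid n k.
Proof. by rewrite addr_ge0// mulr_ge0// ltW. Qed.

Let grid_last n : grid n n.+1 = t0 + h.
Proof. by rewrite /grid /step mulrCA divff ?mulr1// pnatr_eq0. Qed.

(* [e = 1] for crossings forwards in time, [e = - 1] for those backwards. *)
Let drifted (e : R) (n k : nat) (w : T) : R :=
  e * increment W (grid n k) (grid n k.+1) w - a * step n.

Let measurable_drifted e n k : measurable_fun setT (drifted e n k).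
Proof.
apply: measurable_funB => //; apply: measurable_funM => //.
Qed.

Let drifted_indep e n :
  mutually_independent P (fun k => sigma_RV (drifted e n k)).
Proof.
apply: mutually_independentS (bm_independent W_bm (grid_ge0 n 0) (grid_lt n)).
move=> k _ [B mB <-].
exists ((fun x => e * x - a * step n) @^-1` B) => //.
rewrite -[X in measurable X]setTI.
suff: measurable_fun setT (fun x : R => e * x - a * step n) by exact.
by apply: measurable_funB => //; exact: mulrl_measurable.
Qed.

(** The exponent [t = 2 * a / v] is the nonzero root of [t ^+ 2 * v / 2 = t * a]: drift and variance
    cancel and the moment is exactly 1, whatever the step. *)
Let drifted_mgf e n k : e ^+ 2 = 1 ->
  (\int[P]_w (expR ((2 * a / v) * drifted e n k w))%:E <= 1)%E.
Proof.
move=> e2.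
have inc_law := bm_gaussian W_bm (grid_ge0 n k) (grid_lt n k).
rewrite gridS in inc_law.
set t := 2 * a / v.
have sd0 : Num.sqrt (v * step n) != 0 by rewrite gt_eqF// sqrtr_gt0 mulr_gt0.
have mexp : measurable_fun setT (fun x : R => (expR (t * e * x))%:E).
  apply/measurable_EFinP.
  apply: (measurableT_comp (@measurable_expR R)).
  exact: mulrl_measurable.
under eq_integral => w _.
  rewrite (_ : t * _ = - (t * a * step n) + t * e * increment W (grid n k) (grid n k.+1) w);
    last by rewrite /drifted; ring.
  rewrite expRD EFinM; over.
rewrite ge0_integralZl//; last first.
  apply/measurable_EFinP.
  apply: (measurableT_comp (@measurable_expR R)).
  by apply: measurable_funM => //; exact: measurable_funB.
have mY : measurable_fun setT (increment W (grid n k) (grid n k.+1)).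
  exact: measurable_funB.
rewrite (@ge0_has_law_integral _ _ _ P _ (normal_prob 0 (Num.sqrt (v * step n)))
  (fun x => (expR (t * e * x))%:E) mY inc_law)//.
rewrite normal_mgf// -EFinM -expRD lee_fin -[leRHS]expR0 ler_expR.
rewrite sqr_sqrtr; last by rewrite mulr_ge0// ltW.
rewrite le_eqVlt; apply/orP; left; apply/eqP.
rewrite exprMn e2 /t; move: (step n) => q; field.
by rewrite gt_eqF.
Qed.

Let sum_drifted e n i k w :
  \sum_(j <- iota i k) drifted e n j w =
  e * (W (grid n (i + k)) w - W (grid n i) w) - a * (grid n (i + k) - grid n i).
Proof.
elim: k => [|k IH].
  by rewrite big_nil addn0 !subrr !mulr0 subrr.
rewrite -addn1 iotaD big_cat/= big_seq1 IH /drifted/increment/= -(gridS n (i + k)).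
by rewrite addn1 addnS; ring.
Qed.

Let crossing e n (J : seq nat) b : e ^+ 2 = 1 -> uniq J ->
  measurable [set w | b < lindley (drifted e n) J w] /\
  (P [set w | (b < lindley (drifted e n) J w)%R] <= (expR (- (2 * a * b / v)))%:E)%E.
Proof.
move=> e2 uJ; split.
  rewrite (_ : [set _ | _] = lindley (drifted e n) J @^-1` `]b, +oo[).
    by rewrite -[X in measurable X]setTI; exact: measurable_lindley.
  by apply/seteqP; split => w /=; rewrite in_itv/= andbT.
rewrite (_ : 2 * a * b / v = 2 * a / v * b); last by ring.
apply: lindley_tail => //.
- by rewrite ltW// divr_gt0// mulr_gt0.
- by move=> k; exact: drifted_mgf.
Qed.

(** On a grid, the sums of [drifted 1] over prefixes are the heights of the path above the line of
    slope [a] from its starting point, so one bound on [lindley] controls all grid points. The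
    probability bound is independent of the mesh, which can therefore be refined. *)
Lemma bm_crossing_forward_finite b :
  holds_upto P (expR (- (2 * a * b / v))) (fun w =>
    forall s, t0 <= s -> s <= t0 + h -> W s w - W t0 w <= b + a * (s - t0)).
Proof.
have u n : uniq (iota 0 n.+1) by exact: iota_uniq.
have e2 : 1 ^+ 2 = 1 :> R by rewrite expr1n.
have [F [mF PF FE]] := liminf_measure_le (P := P)
  (fun n => (crossing n b e2 (u n)).1) (fun n => (crossing n b e2 (u n)).2).
exists F; split => // w /FE {FE}FE s t0s sh.
have H := @affine_bound_grid _ (fun s => W s w) _ _ (W t0 w + b - a * t0) a
  t0_ge0 h_gt0 (bm_continuous W_bm (w := w)).
suff : W s w <= W t0 w + b - a * t0 + a * s by lra.
apply: H => // n; have [m nm /negP] := FE n; rewrite -leNgt => Em.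
exists m => // k km; rewrite -/(step m) -/(grid m k).
have := @sum_le_lindley R T nat (drifted 1 m) (iota 0 k) (iota k (m.+1 - k)) w.
rewrite -[k in iota k _]add0n -iotaD subnKC// sum_drifted add0n => Hk.
have grid0 : grid m 0 = t0 by rewrite /grid mul0r addr0.
rewrite grid0 in Hk.
by have := le_trans Hk Em; lra.
Qed.

(** Enumerating the increments in reverse order, with sign [- 1], turns prefix sums into increments
    counted back from [t0 + h]. Independence does not depend on the order, so the same tail bound
    applies. *)
Lemma bm_crossing_backward b :
  holds_upto P (expR (- (2 * a * b / v))) (fun w =>
    forall s, t0 <= s -> s <= t0 + h ->
      W s w - W (t0 + h) w <= b + a * (t0 + h - s)).
Proof.
have u n : uniq (rev (iota 0 n.+1)) by rewrite rev_uniq; exact: iota_uniq.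
have e2 : (- 1) ^+ 2 = 1 :> R by rewrite sqrrN expr1n.
have [F [mF PF FE]] := liminf_measure_le (P := P)
  (fun n => (crossing n b e2 (u n)).1) (fun n => (crossing n b e2 (u n)).2).
exists F; split => // w /FE {FE}FE s t0s sh.
have H := @affine_bound_grid _ (fun s => W s w) _ _
  (W (t0 + h) w + b + a * (t0 + h)) (- a) t0_ge0 h_gt0 (bm_continuous W_bm (w := w)).
suff : W s w <= W (t0 + h) w + b + a * (t0 + h) + - a * s by lra.
apply: H => // n; have [m nm /negP] := FE n; rewrite -leNgt => Em.
exists m => // k km; rewrite -/(step m) -/(grid m k).
have := @sum_le_lindley R T nat (drifted (- 1) m) (rev (iota k (m.+1 - k)))
  (rev (iota 0 k)) w.
rewrite -rev_cat -[k in iota k _]add0n -iotaD subnKC//.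
rewrite (perm_big (iota k (m.+1 - k))) ?perm_rev//= sum_drifted subnKC// grid_last => Hk.
by have := le_trans Hk Em; lra.
Qed.

End line_crossing.

(** The bound does not depend on the horizon [h], so horizons [n.+1] may grow; a given [s] is
    covered by any large enough horizon whose exceptional event fails. *)
Lemma bm_crossing_forward (R : realType) (d : measure_display)
    (T : measurableType d) (P : probability T R) (v : R) (W : R -> {RV P >-> R})
    (a b t0 : R) :
  0 < v -> brownian_motion v W -> 0 < a -> 0 <= t0 ->
  holds_upto P (expR (- (2 * a * b / v))) (fun w =>
    forall s, t0 <= s -> W s w - W t0 w <= b + a * (s - t0)).
Proof.
move=> v0 bmW a0 t00.
have /choice[E HE] n := bm_crossing_forward_finite v0 bmW a0 t00 (ltr0Sn R n) b.
have [F [mF PF FE]] := liminf_measure_le (P := P)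
  (fun n => let: And3 mE _ _ := HE n in mE) (fun n => let: And3 _ PE _ := HE n in PE).
exists F; split => // w /FE {FE}FE s t0s.
have [m nm] := FE (Num.truncn (s - t0)).
have [_ _ H] := HE m; move=> /H; apply => //.
rewrite -lerBlDl ltW//.
have st0 : 0 <= s - t0 by rewrite subr_ge0.
have /andP[_ sm] := truncn_itv st0.
by apply: (lt_le_trans sm); rewrite ler_nat.
Qed.

(** * The maximum of the suprema *)

Lemma continuous_within_gt_rat (R : realType) (g : R -> R) (s y : R) :
  {within `[0, +oo[, continuous g} -> 0 < s -> y < g s ->
  exists n k, y < g (k.+1%:R / n.+1%:R).
Proof.
move=> /subspace_continuousP cg s0 ys.
have /cvgrPdist_lt/(_ (g s - y)) : g @ within `[0, +oo[ (nbhs s) --> g s.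
  by apply: cg; rewrite /= in_itv/= ltW.
rewrite subr_gt0 => /(_ ys); rewrite /within/= => -[dl /= dl0 near_s].
(* [k.+1%:R / n.+1%:R] approximates [s] from the right, which keeps it positive, within
   [n.+1%:R^-1 < dl]. *)
pose n := Num.truncn dl^-1; pose k := Num.truncn (s * n.+1%:R).
have n0 : (0 : R) < n.+1%:R by rewrite ltr0n.
have ndl : n.+1%:R^-1 < dl.
  rewrite -[ltRHS]invrK ltf_pV2 ?posrE ?invr_gt0//.
  have dl'0 : 0 <= dl^-1 by rewrite invr_ge0 ltW.
  by have /andP[] := truncn_itv dl'0.
have /andP[k1 k2] : k%:R <= s * n.+1%:R < k.+1%:R.
  by apply: truncn_itv; rewrite mulr_ge0// ltW.
exists n, k.
have sk : s < k.+1%:R / n.+1%:R by rewrite ltr_pdivlMr.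
have ks : k.+1%:R / n.+1%:R <= s + n.+1%:R^-1.
  by rewrite -natr1 mulrDl mul1r lerD2r ler_pdivrMr.
have : `|g s - g (k.+1%:R / n.+1%:R)| < g s - y.
  apply: near_s => /=; last by rewrite in_itv/= andbT divr_ge0.
  rewrite ltr0_norm ?subr_lt0// opprB ltrBlDl.
  by apply: (le_lt_trans ks); rewrite ltrD2l.
by rewrite ltr_norml => /andP[_]; lra.
Qed.

(** By continuity the supremum exceeds [y] exactly when the path does so at some positive rational
    time, which makes the event a countable union. *)
Lemma measurable_sup_path (R : realType) (d : measure_display)
    (T : measurableType d) (g : R -> T -> R) :
  (forall s, measurable_fun setT (g s)) ->
  (forall w, {within `[0, +oo[, continuous (g ^~ w)}) ->
  measurable_fun setT (fun w => ereal_sup [set (g s w)%:E | s in `]0, +oo[]).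
Proof.
move=> mg cg mD; apply: (measurability _ (ErealGenOInfty.measurableE R)) => //.
move=> _ [_ [y ->] <-]; rewrite setTI.
rewrite (_ : _ @^-1` _ =
    \bigcup_n \bigcup_k (g (k.+1%:R / n.+1%:R) @^-1` `]y, +oo[)).
  apply: bigcupT_measurable => n; apply: bigcupT_measurable => k.
  by rewrite -[X in measurable X]setTI; exact: mg.
apply/seteqP; split => w /=.
  rewrite in_itv/= andbT => /ereal_sup_gt[_ [s /= + <-]].
  rewrite in_itv/= andbT lte_fin => s0 ys.
  have [n [k nk]] := continuous_within_gt_rat (cg w) s0 ys.
  by exists n => //; exists k => //=; rewrite in_itv/= nk.
move=> [n _ [k _ /=]]; rewrite !in_itv/= !andbT => yg.
apply: (@lt_le_trans _ _ (g (k.+1%:R / n.+1%:R) w)%:E); first by rewrite lte_fin.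
apply: ereal_sup_ubound; exists (k.+1%:R / n.+1%:R) => //=.
by rewrite in_itv/= andbT divr_gt0 ?ltr0n.
Qed.

Lemma measurable_normalized_max (R : realType) (d : measure_display)
    (T : measurableType d) (P : probability T R) (sigma beta : R)
    (W : nat -> R -> {RV P >-> R}) (WA : R -> {RV P >-> R}) (N : nat) :
  (forall i w, {within `[0, +oo[, continuous (fun t => W i t w)}) ->
  (forall w, {within `[0, +oo[, continuous (fun t => WA t w)}) ->
  measurable_fun setT (normalized_max sigma beta W WA N).
Proof.
move=> cW cWA.
have msup i : measurable_fun setT (fun w => ereal_sup
    [set (W i s w + WA s w - beta * s)%:E | s in `]0, +oo[]).
  apply: (@measurable_sup_path _ _ _ (fun s w => W i s w + WA s w - beta * s)).
    by move=> s; apply: measurable_funB => //; exact: measurable_funD.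
  move=> w x; apply: cvgB; first by apply: cvgD; [exact: cW|exact: cWA].
  apply: continuous_subspaceT => z.
  exact: mulrl_continuous.
have mmax n : measurable_fun setT (max_sup W WA beta n).
  rewrite /max_sup; elim: n => [|n IH].
    by under eq_fun do rewrite big_ord0; exact: measurable_cst.
  under eq_fun do rewrite big_ord_recr/=.
  exact: measurable_maxe.
apply: emeasurable_funM; last exact: measurable_cst.
by apply: emeasurable_funB => //; exact: measurable_cst.
Qed.

(** The path starts at 0 only almost surely, so [W s] and the increment from 0 are compared outside
    a null set [N]. *)
Lemma bm_marginal (R : realType) (d : measure_display)
    (T : measurableType d) (P : probability T R) (v : R) (W : R -> {RV P >-> R})
    (s : R) :
  brownian_motion v W -> 0 < s -> has_law P (W s) (normal_prob 0 (Num.sqrt (v * s))).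
Proof.
move=> bmW s0 B mB.
have := bm_gaussian bmW (lexx 0) s0 mB; rewrite subr0 => <-.
have [N [mN PN N0]] := bm_start bmW.
have mpre (Y : T -> R) : measurable_fun setT Y -> measurable (Y @^-1` B).
  by move=> mY; rewrite -[X in measurable X]setTI; exact: mY.
have m1 : measurable (W s @^-1` B) by exact: mpre.
have m2 : measurable (increment W 0 s @^-1` B).
  by apply: mpre; exact: measurable_funB.
have W0 w : ~ N w -> increment W 0 s w = W s w.
  move=> Nw; have : W 0 w = 0 by apply: contrapT => ?; exact/Nw/N0.
  by rewrite /increment/= => ->; rewrite subr0.
have PU A : measurable A -> P (A `|` N) = P A.
  move=> mA; apply/eqP; rewrite eq_le; apply/andP; split.
    by apply: (le_trans (measureU2 _ _ _)) => //; rewrite [X in (_ + X)%E]PN adde0.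
  by apply: le_measure; rewrite ?inE//; exact: measurableU.
apply/eqP; rewrite eq_le; apply/andP; split.
- rewrite -(PU _ m2); apply: le_measure; rewrite ?inE//; first exact: measurableU.
  move=> w /= Bw; have [?|Nw] := pselect (N w); first by right.
  by left; rewrite /= W0.
- rewrite -(PU _ m1); apply: le_measure; rewrite ?inE//; first exact: measurableU.
  move=> w /= Bw; have [?|Nw] := pselect (N w); first by right.
  by left; rewrite /= -W0.
Qed.

(** The product of the [N] factors is handled through [1 - p <= expR (- p)]. *)
Lemma mutually_independent_all_le (R : realType) (d : measure_display)
    (T : measurableType d) (P : probability T R) (F : nat -> set (set T))
    (A : nat -> set T) (p : R) (N : nat) :
  mutually_independent P F -> (forall i, F i (A i)) ->
  (forall i, (P (A i) <= (1 - p)%:E)%E) ->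
  (P (\bigcap_(i in [set` iota 0 N]) A i) <= (expR (- (N%:R * p)))%:E)%E.
Proof.
move=> indF FA PA; rewrite indF ?iota_uniq//.
elim: N => [|N IH]; first by rewrite big_nil mul0r oppr0 expR0.
rewrite -addn1 iotaD big_cat/= big_seq1 natrD mulrDl mul1r opprD expRD EFinM.
apply: lee_pmul => //.
  by elim/big_ind : _ => // x y; exact: mule_ge0.
apply: (le_trans (PA _)); rewrite lee_fin.
by have := expR_ge1Dx (- p); lra.
Qed.

(** * Upper bound by tilted lines *)

(* Here [r] stands for [(ln N)^(1/4)]. The value of [g ^+ 2] makes the second-order
   error [4 * u ^+ 2 * top] equal to [2 / 3 * delta * r ^+ 2], the last third being
   left to the fluctuations of [WA]. *)
Section tilted_lines.
Context (R : realType) (sigma beta delta g r : R).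
Hypotheses (sigma_gt0 : 0 < sigma) (beta_gt0 : 0 < beta) (g_gt0 : 0 < g)
  (r_gt0 : 0 < r) (gr : g <= r / 2)
  (g2 : g ^+ 2 = delta * beta / (3 * sigma ^+ 2)).

Let u := g / r.
Let tstar := sigma ^+ 2 / (2 * beta ^+ 2) * r ^+ 4.
Let top := sigma ^+ 2 / (2 * beta) * r ^+ 4.

Let u_gt0 : 0 < u. Proof. by rewrite divr_gt0. Qed.

Let u_le : u <= 2^-1. Proof. by rewrite ler_pdivrMr// mulrC. Qed.

Let curvature : 4 * u ^+ 2 * top = 2 / 3 * delta * r ^+ 2.
Proof.
have -> : delta = 3 * sigma ^+ 2 / beta * g ^+ 2.
  by rewrite g2; field; rewrite !gt_eqF.
by rewrite /u /top; field; rewrite !gt_eqF.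
Qed.

Let top_gt0 : 0 < top.
Proof. by rewrite mulr_gt0 ?exprn_gt0// divr_gt0 ?mulr_gt0 ?exprn_gt0. Qed.

Let tstarE : beta * tstar = top.
Proof. by rewrite /tstar /top; field; rewrite gt_eqF. Qed.

(** Expanding, [(1 + u ^+ 2) / (1 - u) = 1 + u + 2 * u ^+ 2 / (1 - u)]. The first-order excess
    [u * top] is cancelled by [beta * u * tstar], the terms in [s] cancel as well, and [u <= 2^-1]
    bounds the rest by [curvature]. *)
Lemma tilted_line_right (s x y z : R) :
  x <= top * (1 + u ^+ 2) / (1 - u) + beta * (1 - u) * s ->
  y - z <= delta / 3 * r ^+ 2 + beta * u * (s - tstar) ->
  x + y - beta * s <= z + top + delta * r ^+ 2.
Proof.
move=> hx hy.
have e : top * (1 + u ^+ 2) / (1 - u) = top + u * top + 2 * u ^+ 2 * top / (1 - u).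
  by field; rewrite gt_eqF//; have := u_le; lra.
have : 2 * u ^+ 2 * top / (1 - u) <= 4 * u ^+ 2 * top.
  rewrite ler_pdivrMr; last by have := u_le; lra.
  have : 0 <= u ^+ 2 * top by rewrite mulr_ge0 ?sqr_ge0// ltW.
  by have := u_le; nra.
rewrite curvature; rewrite e in hx.
have : beta * u * tstar = u * top by rewrite -tstarE; ring.
by nra.
Qed.

(** The mirror image, with [(1 + u ^+ 2) / (1 + u) = 1 - u + 2 * u ^+ 2 / (1 + u)]. *)
Lemma tilted_line_left (s x y z : R) :
  x <= top * (1 + u ^+ 2) / (1 + u) + beta * (1 + u) * s ->
  y - z <= delta / 3 * r ^+ 2 + beta * u * (tstar - s) ->
  x + y - beta * s <= z + top + delta * r ^+ 2.
Proof.
move=> hx hy.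
have u1 : 0 < 1 + u by have := u_gt0; lra.
have e : top * (1 + u ^+ 2) / (1 + u) = top - u * top + 2 * u ^+ 2 * top / (1 + u).
  by field; rewrite gt_eqF.
have : 2 * u ^+ 2 * top / (1 + u) <= 4 * u ^+ 2 * top.
  rewrite ler_pdivrMr//.
  have : 0 <= u ^+ 2 * top by rewrite mulr_ge0 ?sqr_ge0// ltW.
  by have := u_gt0; nra.
rewrite curvature; rewrite e in hx.
have : beta * u * tstar = u * top by rewrite -tstarE; ring.
by nra.
Qed.

Context (d : measure_display) (T : measurableType d) (P : probability T R)
  (sigmaA : R) (W : nat -> R -> {RV P >-> R}) (WA : R -> {RV P >-> R}) (N : nat).
Hypotheses (sigmaA_gt0 : 0 < sigmaA)
  (W_bm : forall i, brownian_motion (sigma ^+ 2) (W i))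
  (WA_bm : brownian_motion (sigmaA ^+ 2) WA)
  (NE : N%:R = expR (r ^+ 4) :> R).

Lemma max_upper_bound :
  holds_upto P (2 * expR (- (g ^+ 2 * r ^+ 2)) +
      2 * expR (- (2 * delta * beta * g / (3 * sigmaA ^+ 2) * r)))
    (fun w => forall i s, (i < N)%N -> 0 < s ->
      W i s w + WA s w - beta * s <= WA tstar w + top + delta * r ^+ 2).
Proof.
have sig2 : 0 < sigma ^+ 2 by rewrite exprn_gt0.
have sigA2 : 0 < sigmaA ^+ 2 by rewrite exprn_gt0.
have u1 : 0 < 1 - u by have := u_le; lra.
have u2 : 0 < 1 + u by have := u_gt0; lra.
have tstar_gt0 : 0 < tstar by rewrite mulr_gt0 ?exprn_gt0// divr_gt0 ?mulr_gt0 ?exprn_gt0.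
(* The intercept is chosen so that twice its product with the slope, over [sigma ^+ 2], is [r ^+ 4 *
   (1 + u ^+ 2) = r ^+ 4 + g ^+ 2 * r ^+ 2] for both signs [e]. The first term pays for the union
   bound over [N = expR (r ^+ 4)] processes. *)
pose line (e : R) (i : nat) (w : T) := forall s, 0 <= s ->
  W i s w <= top * (1 + u ^+ 2) / (1 + e * u) + beta * (1 + e * u) * s.
have Hline (e : R) : 0 < 1 + e * u -> holds_upto P (expR (- (g ^+ 2 * r ^+ 2)))
    (fun w => forall i, (i < N)%N -> line e i w).
  move=> eu.
  have H i : holds_upto P (expR (- (r ^+ 4 + g ^+ 2 * r ^+ 2))) (line e i).
    have a0 : 0 < beta * (1 + e * u) by rewrite mulr_gt0.
    have := bm_crossing_forward (top * (1 + u ^+ 2) / (1 + e * u))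
      sig2 (W_bm i) a0 (lexx 0).
    move/(holds_upto_and (holds_upto_ae (bm_start (W_bm i)))).
    apply: holds_uptoS.
      rewrite add0r le_eqVlt; apply/orP; left; apply/eqP; congr (expR (- _)).
      have r0 : r != 0 by rewrite gt_eqF.
      have b0 : beta != 0 by rewrite gt_eqF.
      have s0 : sigma != 0 by rewrite gt_eqF.
      rewrite /top; move: (gt_eqF eu) => /negbT eu0.
      have -> : g = u * r by rewrite /u divfK.
      by field; rewrite eu0 b0 s0.
    move=> w [w0 Hw] s s0; have := Hw s s0; rewrite w0; lra.
  have := holds_upto_all N H; apply: holds_uptoS => //.
  by rewrite NE opprD expRD mulrA -expRD subrr expR0 mul1r.
have HA : holds_upto P (expR (- (2 * delta * beta * g / (3 * sigmaA ^+ 2) * r)))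
    (fun w => forall s, tstar <= s ->
      WA s w - WA tstar w <= delta / 3 * r ^+ 2 + beta * u * (s - tstar)).
  have a0 : 0 < beta * u by rewrite mulr_gt0.
  have := bm_crossing_forward (delta / 3 * r ^+ 2) sigA2 WA_bm a0 (ltW tstar_gt0).
  apply: holds_uptoS => //.
  rewrite le_eqVlt; apply/orP; left; apply/eqP; congr (expR (- _)).
  by rewrite /u; field; rewrite !gt_eqF.
have HB : holds_upto P (expR (- (2 * delta * beta * g / (3 * sigmaA ^+ 2) * r)))
    (fun w => forall s, 0 <= s -> s <= tstar ->
      WA s w - WA tstar w <= delta / 3 * r ^+ 2 + beta * u * (tstar - s)).
  have a0 : 0 < beta * u by rewrite mulr_gt0.
  have := bm_crossing_backward sigA2 WA_bm a0 (lexx 0) tstar_gt0 (delta / 3 * r ^+ 2).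
  apply: holds_uptoS => //.
    rewrite le_eqVlt; apply/orP; left; apply/eqP; congr (expR (- _)).
    by rewrite /u; field; rewrite !gt_eqF.
  by move=> w; rewrite add0r.
have uN1 : 0 < 1 + (- 1) * u by rewrite mulN1r.
have uP1 : 0 < 1 + 1 * u by rewrite mul1r.
have := holds_upto_and (holds_upto_and (Hline _ uN1) (Hline _ uP1)) (holds_upto_and HA HB).
apply: holds_uptoS; first by lra.
move=> w [[HR HL] [Hr Hl]] i s iN s0.
(* After [tstar] the flatter line leaves room for [WA] to grow; before [tstar] the steeper one
   does. *)
have [ts|st] := leP tstar s.
  apply: (tilted_line_right (s := s)); last exact: Hr.
  by have := HR i iN s (ltW s0); rewrite mulN1r.
apply: (tilted_line_left (s := s)); last exact: Hl (ltW s0) (ltW st).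
by have := HL i iN s (ltW s0); rewrite mul1r.
Qed.

End tilted_lines.

(** * Lower bound at the peak time *)

Lemma normal_peakM (R : realType) (c k : R) : 0 < k ->
  normal_peak (c * k) = normal_peak c / k.
Proof.
move=> k0; rewrite /normal_peak exprMn.
rewrite (_ : c ^+ 2 * k ^+ 2 * pi *+ 2 = k ^+ 2 * (c ^+ 2 * pi *+ 2)); last by ring.
by rewrite sqrtrM ?sqr_ge0// sqrtr_sqr gtr0_norm// invfM mulrC.
Qed.

Lemma normal_prob_le_tail (R : realType) (s a b : R) :
  0 < s -> 0 <= a -> a <= b ->
  (normal_prob 0 s `]-oo, a] <= (1 - (b - a) * normal_pdf 0 s b)%:E)%E.
Proof.
move=> s0 a0 ab.
have : (normal_prob 0 s `]-oo, a] + normal_prob 0 s `]a, b] <= 1)%E.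
  rewrite -measureU//=.
    by apply: probability_le1; exact: measurableU.
  rewrite -subset0 => y []/=; rewrite !in_itv/= => ya /andP[].
  by rewrite ltNge ya.
rewrite EFinB leeBrDr//; apply: le_trans; rewrite leeD2l//.
exact: normal_prob_itv_ge.
Qed.

Section lower_bound.
Context (R : realType) (sigma beta delta r : R)
  (d : measure_display) (T : measurableType d) (P : probability T R)
  (W : nat -> R -> {RV P >-> R}) (N : nat).
Hypotheses (sigma_gt0 : 0 < sigma) (beta_gt0 : 0 < beta) (delta_gt0 : 0 < delta)
  (r_gt0 : 0 < r) (r_large : delta * beta <= sigma ^+ 2 * r ^+ 2)
  (W_bm : forall i, brownian_motion (sigma ^+ 2) (W i))
  (W_indep : mutually_independent P (fun i => sigma_process (W i)))
  (NE : N%:R = expR (r ^+ 4) :> R).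

Let tstar := sigma ^+ 2 / (2 * beta ^+ 2) * r ^+ 4.
Let m := delta * beta / (2 * sigma ^+ 2).
Let c := sigma ^+ 2 / (Num.sqrt 2 * beta).

(** The threshold is twice the level of the peak, up to [delta * r ^+ 2], because the drift takes
    away [beta * tstar], which is once that level. Independence bounds the probability that all
    [W i tstar] stay below it. *)
Lemma max_lower_bound :
  holds_upto P
    (expR (- (delta / 2 * normal_peak c * expR (2 * m * r ^+ 2 - m ^+ 2))))
    (fun w => exists2 i, (i < N)%N &
       sigma ^+ 2 / beta * r ^+ 4 - delta * r ^+ 2 < W i tstar w).
Proof.
have sig2 : 0 < sigma ^+ 2 by rewrite exprn_gt0.
have tstar_gt0 : 0 < tstar by rewrite mulr_gt0 ?exprn_gt0// divr_gt0 ?mulr_gt0 ?exprn_gt0.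
pose sd := Num.sqrt (sigma ^+ 2 * tstar).
have c0 : 0 < c by rewrite divr_gt0 ?exprn_gt0// mulr_gt0 ?sqrtr_gt0.
have c2 : c ^+ 2 = sigma ^+ 4 / (2 * beta ^+ 2).
  rewrite /c expr_div_n [(_ * beta) ^+ 2]exprMn sqr_sqrtr//.
  by field; rewrite gt_eqF.
have r20 : 0 < r ^+ 2 by rewrite exprn_gt0.
have sdE : sd = c * r ^+ 2.
  have cr0 := ltW (mulr_gt0 c0 r20); have st0 := ltW (mulr_gt0 sig2 tstar_gt0).
  apply/eqP; rewrite -(@eqrXn2 _ 2) ?sqrtr_ge0//.
  rewrite sqr_sqrtr//.
  rewrite exprMn c2 /tstar; apply/eqP.
  by field; rewrite gt_eqF.
have sd0 : 0 < sd by rewrite sdE mulr_gt0.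
(* [a] is the threshold and [b] leaves a window of width [delta / 2 * r ^+ 2] above it, still below
   [sigma ^+ 2 / beta * r ^+ 4]. The assumption [r_large] makes [a] nonnegative. *)
pose a := sigma ^+ 2 / beta * r ^+ 4 - delta * r ^+ 2.
pose b := sigma ^+ 2 / beta * r ^+ 4 - delta / 2 * r ^+ 2.
have a0 : 0 <= a.
  rewrite (_ : a = (sigma ^+ 2 * r ^+ 2 - delta * beta) / beta * r ^+ 2).
    apply: mulr_ge0; last exact: ltW.
    by apply: divr_ge0; [rewrite subr_ge0|exact: ltW].
  by rewrite /a; field; rewrite gt_eqF.
have baE : b - a = delta / 2 * r ^+ 2.
  by rewrite /a /b; lra.
have ab : a <= b.
  rewrite -subr_ge0 baE; apply: mulr_ge0; last exact: ltW.
  by rewrite divr_ge0// ltW.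
pose p := (b - a) * normal_pdf 0 sd b.
have NpE : N%:R * p = delta / 2 * normal_peak c * expR (2 * m * r ^+ 2 - m ^+ 2).
  rewrite NE /p baE normal_pdfE ?gt_eqF// {1}sdE normal_peakM// /normal_fun subr0.
  (* The exponent is [- (r ^+ 2 - m) ^+ 2]; its leading term [- r ^+ 4] is compensated by the number
     [N] of processes, and [2 * m * r ^+ 2] remains as a gain. *)
  rewrite (_ : - b ^+ 2 / (sd ^+ 2 *+ 2) = - r ^+ 4 + (2 * m * r ^+ 2 - m ^+ 2)).
    rewrite expRD expRN; field.
    by rewrite !gt_eqF ?expR_gt0.
  rewrite sdE exprMn c2 /b /m; field.
  by rewrite !gt_eqF.
pose A i := W i tstar @^-1` `]-oo, a].
have mA i : measurable (A i) by rewrite -[X in measurable X]setTI; exact: measurable_funP.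
exists (\bigcap_(i in [set` iota 0 N]) A i); split.
- by apply: bigcap_measurableType => i _.
- rewrite -NpE; apply: mutually_independent_all_le W_indep _ _ => i.
    apply: sub_sigma_algebra; exists tstar; first by rewrite /= in_itv/= ltW.
    by exists `]-oo, a]%classic => //; rewrite setTI.
  rewrite /A (bm_marginal (W_bm i) tstar_gt0)//.
  exact: normal_prob_le_tail.
move=> w Aw; apply: contrapT => H; apply: Aw => i /=.
rewrite mem_iota add0n /= => iN; rewrite /A/= in_itv/= leNgt; apply/negP => aW.
by apply: H; exists i.
Qed.

End lower_bound.

(** * Two-sided approximation of the maximum *)

Lemma near_fourth_root_ln (R : realType) (c : R) :
  \forall N \near \oo, c <= Num.sqrt (Num.sqrt (ln N%:R)).
Proof.
near=> N.
have cN : expR (Num.max c 0 ^+ 4) <= N%:R by near: N; exact: nbhs_infty_ger.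
have N0 : (0 : R) < N%:R by apply: lt_le_trans cN; exact: expR_gt0.
have c0 : 0 <= Num.max c 0 by rewrite le_max lexx orbT.
apply: (@le_trans _ _ (Num.max c 0)); first by rewrite le_max lexx.
have le4 : Num.max c 0 ^+ 4 <= ln N%:R.
  by rewrite -ler_expR lnK// posrE.
have le2 : Num.max c 0 ^+ 2 <= Num.sqrt (ln N%:R).
  by rewrite -[leLHS]ger0_norm ?sqr_ge0// -sqrtr_sqr -exprM ler_wsqrtr.
by rewrite -[leLHS]ger0_norm// -sqrtr_sqr ler_wsqrtr.
Unshelve. all: by end_near. Qed.

Lemma fourth_root_lnK (R : realType) (N : nat) : (0 < N)%N ->
  Num.sqrt (Num.sqrt (ln N%:R)) ^+ 4 = ln N%:R :> R.
Proof.
move=> N0; have l0 : 0 <= ln N%:R :> R by rewrite ln_ge0// ler1n.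
by rewrite -[4%N]/(2 * 2)%N exprM !sqr_sqrtr ?sqrtr_ge0.
Qed.

(** From [1 + K <= expR K]; it reduces the smallness of each exceptional probability to a lower
    bound on its exponent. *)
Lemma expRN_le (R : realType) (e K : R) : 0 < e -> e^-1 <= K -> expR (- K) <= e.
Proof.
move=> e0 eK; have K0 : 0 < K by apply: lt_le_trans eK; rewrite invr_gt0.
rewrite expRN -[leRHS]invrK lef_pV2 ?posrE ?expR_gt0 ?invr_gt0//.
by apply: (le_trans eK); apply: le_trans (expR_ge1Dx K); rewrite lerDr.
Qed.

Section max_sup_approximation.
Context (R : realType) (d : measure_display) (T : measurableType d)
    (P : probability T R) (sigma sigmaA beta : R)
    (W : nat -> R -> {RV P >-> R}) (WA : R -> {RV P >-> R}).
Hypotheses (sigma_gt0 : 0 < sigma) (sigmaA_gt0 : 0 < sigmaA) (beta_gt0 : 0 < beta)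
    (W_bm : forall i, brownian_motion (sigma ^+ 2) (W i))
    (W_indep : mutually_independent P (fun i => sigma_process (W i)))
    (WA_bm : brownian_motion (sigmaA ^+ 2) WA).

Let tstar (N : nat) := sigma ^+ 2 / (2 * beta ^+ 2) * ln N%:R.

Lemma max_sup_approximation (delta e : R) : 0 < delta -> 0 < e ->
  \forall N \near \oo, holds_upto P e (fun w =>
    ((WA (tstar N) w + sigma ^+ 2 / (2 * beta) * ln N%:R
       - delta * Num.sqrt (ln N%:R))%:E <= max_sup W WA beta N w /\
     max_sup W WA beta N w <= (WA (tstar N) w + sigma ^+ 2 / (2 * beta) * ln N%:R
       + delta * Num.sqrt (ln N%:R))%:E)%E).
Proof.
move=> delta0 e0.
have sig2 : 0 < sigma ^+ 2 by rewrite exprn_gt0.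
have sigA2 : 0 < sigmaA ^+ 2 by rewrite exprn_gt0.
pose g := Num.sqrt (delta * beta / (3 * sigma ^+ 2)).
have g20 : 0 < delta * beta / (3 * sigma ^+ 2) by rewrite divr_gt0// mulr_gt0.
have g2 : g ^+ 2 = delta * beta / (3 * sigma ^+ 2) by rewrite sqr_sqrtr// ltW.
have g0 : 0 < g by rewrite sqrtr_gt0.
pose m := delta * beta / (2 * sigma ^+ 2).
have m0 : 0 < m by rewrite divr_gt0 ?mulr_gt0.
pose c := sigma ^+ 2 / (Num.sqrt 2 * beta).
have c0 : 0 < c by rewrite divr_gt0// mulr_gt0 ?sqrtr_gt0.
pose C := delta / 2 * normal_peak c.
have C0 : 0 < C by rewrite mulr_gt0 ?divr_gt0// normal_peak_gt0// gt_eqF.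
pose k := 2 * delta * beta * g / (3 * sigmaA ^+ 2).
have k0 : 0 < k by rewrite divr_gt0 ?mulr_gt0.
(* Five exponential terms are to be made small: four from the upper bound, in two equal pairs, and
   one from the lower bound. *)
pose K := (e / 5)^-1.
have e5 : 0 < e / 5 by rewrite divr_gt0.
near=> N.
pose r := Num.sqrt (Num.sqrt (ln N%:R)) : R.
have N0 : (0 < N)%N by near: N; exact: nbhs_infty_gt.
have r1 : 1 <= r by rewrite /r; near: N; exact: near_fourth_root_ln.
have r0 : 0 < r by apply: lt_le_trans r1.
have rr : r <= r ^+ 2 by rewrite ler_eXnr.
have r4 : r ^+ 4 = ln N%:R by exact: fourth_root_lnK.
have r2 : r ^+ 2 = Num.sqrt (ln N%:R) by rewrite sqr_sqrtr ?sqrtr_ge0.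
have NE : N%:R = expR (r ^+ 4) :> R by rewrite r4 lnK// posrE ltr0n.
have gr : g <= r / 2.
  have : 2 * g <= r by rewrite /r; near: N; exact: near_fourth_root_ln.
  lra.
have r_large : delta * beta <= sigma ^+ 2 * r ^+ 2.
  have : delta * beta / sigma ^+ 2 <= r by rewrite /r; near: N; exact: near_fourth_root_ln.
  rewrite ler_pdivrMr// => /le_trans; apply.
  by rewrite mulrC ler_wpM2l// ltW.
have t1 : expR (- (g ^+ 2 * r ^+ 2)) <= e / 5.
  apply: expRN_le => //.
  have : K / g ^+ 2 <= r by rewrite /r; near: N; exact: near_fourth_root_ln.
  rewrite ler_pdivrMr ?exprn_gt0// mulrC => /le_trans; apply.
  by rewrite ler_wpM2l// sqr_ge0.
have t2 : expR (- (k * r)) <= e / 5.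
  apply: expRN_le => //.
  have : K / k <= r by rewrite /r; near: N; exact: near_fourth_root_ln.
  by rewrite ler_pdivrMr// mulrC.
have t3 : expR (- (C * expR (2 * m * r ^+ 2 - m ^+ 2))) <= e / 5.
  apply: expRN_le => //.
  have : (K / C + m ^+ 2) / (2 * m) <= r by rewrite /r; near: N; exact: near_fourth_root_ln.
  have m20 : 0 < 2 * m by exact: mulr_gt0.
  rewrite ler_pdivrMr// => H.
  rewrite -/K mulrC -ler_pdivrMr//.
  apply: le_trans (expR_ge1Dx _).
  (* Since [1 <= r], a requirement linear in [r] also gives the one in [r ^+ 2]; with it the inner
     exponent is at least [K / C]. *)
  have : r * (2 * m) <= r ^+ 2 * (2 * m) by rewrite ler_wpM2r// ltW.
  lra.
have := holds_upto_and
  (max_upper_bound sigma_gt0 beta_gt0 g0 r0 gr g2 sigmaA_gt0 W_bm WA_bm NE)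
  (max_lower_bound sigma_gt0 beta_gt0 delta0 r0 r_large W_bm W_indep NE).
apply: holds_uptoS; first by rewrite -/k -/m -/c -/C; lra.
rewrite r4 r2 -/(tstar N) => w [up [i iN lo]].
have ts0 : 0 < tstar N.
  by rewrite /tstar -r4 mulr_gt0 ?exprn_gt0// divr_gt0 ?mulr_gt0 ?exprn_gt0.
split.
(* The single index [i] and the single time [tstar N] already give the lower bound. *)
- apply: (@le_trans _ _ (W i (tstar N) w + WA (tstar N) w - beta * tstar N)%:E).
    rewrite lee_fin.
    have : beta * tstar N = sigma ^+ 2 / (2 * beta) * ln N%:R.
      by rewrite /tstar; field; rewrite gt_eqF.
    have : sigma ^+ 2 / beta * ln N%:R = 2 * (sigma ^+ 2 / (2 * beta) * ln N%:R).
      by field; rewrite gt_eqF.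
    lra.
  rewrite /max_sup; apply: (bigmax_sup (Ordinal iN)) => //=.
  apply: ereal_sup_ubound; exists (tstar N) => //=.
  by rewrite in_itv/= andbT.
- apply: bigmax_le => [|j _]; first by rewrite leNye.
  apply: ge_ereal_sup => _ [s /= + <-]; rewrite in_itv/= andbT => s0.
  by rewrite lee_fin; exact: up.
Unshelve. all: by end_near. Qed.

End max_sup_approximation.

(** * Convergence in distribution *)

Lemma Phi_fin_num (R : realType) (x : R) : Phi x \is a fin_num.
Proof. exact: fin_num_measure. Qed.

Section tail_convergence.
Context (R : realType) (d : measure_display) (T : measurableType d)
    (P : probability T R) (sigma sigmaA beta : R)
    (W : nat -> R -> {RV P >-> R}) (WA : R -> {RV P >-> R}).
Hypotheses (sigma_gt0 : 0 < sigma) (sigmaA_gt0 : 0 < sigmaA) (beta_gt0 : 0 < beta)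
    (W_bm : forall i, brownian_motion (sigma ^+ 2) (W i))
    (W_indep : mutually_independent P (fun i => sigma_process (W i)))
    (WA_bm : brownian_motion (sigmaA ^+ 2) WA).

Let kappa := sigma * sigmaA / (Num.sqrt 2 * beta).
Let tstar (N : nat) := sigma ^+ 2 / (2 * beta ^+ 2) * ln N%:R.

Let kappa_gt0 : 0 < kappa.
Proof. by rewrite divr_gt0 ?mulr_gt0 ?sqrtr_gt0. Qed.

Let measurable_tail N (x : R) :
  measurable [set w | (x%:E < normalized_max sigma beta W WA N w)%E].
Proof.
have mY := @measurable_normalized_max _ _ _ P sigma beta W WA N
  (fun i w => bm_continuous (W_bm i) (w := w)) (fun w => bm_continuous WA_bm (w := w)).
rewrite (_ : [set _ | _] = normalized_max sigma beta W WA N @^-1` `]x%:E, +oo[).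
  by rewrite -[X in measurable X]setTI; apply: mY => //; exact: emeasurable_itv.
by apply/seteqP; split => w /=; rewrite in_itv/= andbT.
Qed.

(** The standard deviation of [WA (tstar N)] is exactly [kappa * Num.sqrt (ln N%:R)], so after
    scaling its law does not depend on [N] and is already the limit law. *)
Let WA_tail N (y : R) : 0 < ln N%:R :> R ->
  measurable [set w | y * Num.sqrt (ln N%:R) < WA (tstar N) w] /\
  P [set w | y * Num.sqrt (ln N%:R) < WA (tstar N) w] = (1 - fine (Phi (y / kappa)))%:E.
Proof.
move=> L0; have l0 : 0 < Num.sqrt (ln N%:R) :> R by rewrite sqrtr_gt0.
have ts0 : 0 < tstar N by rewrite mulr_gt0// divr_gt0 ?mulr_gt0 ?exprn_gt0.
have sdE : Num.sqrt (sigmaA ^+ 2 * tstar N) = kappa * Num.sqrt (ln N%:R).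
  have h1 : 0 <= kappa * Num.sqrt (ln N%:R) by rewrite ltW// mulr_gt0.
  have h2 : 0 <= sigmaA ^+ 2 * tstar N by rewrite ltW// mulr_gt0// exprn_gt0.
  apply/eqP; rewrite -(@eqrXn2 _ 2) ?sqrtr_ge0//.
  rewrite sqr_sqrtr// /kappa [(_ * Num.sqrt (ln _)) ^+ 2]exprMn expr_div_n.
  rewrite [(Num.sqrt 2 * beta) ^+ 2]exprMn !sqr_sqrtr ?(ltW L0)// /tstar.
  by apply/eqP; field; rewrite gt_eqF.
pose B := WA (tstar N) @^-1` `]-oo, y * Num.sqrt (ln N%:R)].
have mB : measurable B by rewrite -[X in measurable X]setTI; exact: measurable_funP.
have -> : [set w | y * Num.sqrt (ln N%:R) < WA (tstar N) w] = ~` B.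
  by apply/seteqP; split => w; rewrite /B/= in_itv/= ltNge => /negP.
have kl0 := mulr_gt0 kappa_gt0 l0.
split; first exact: measurableC.
rewrite probability_setC// (bm_marginal WA_bm ts0)// sdE normal_prob_Phi//.
rewrite invfM mulrACA divff ?gt_eqF// mulr1 EFinB fineK//.
exact: Phi_fin_num.
Qed.

(** Outside an event of probability at most [e / 2], the normalized maximum is within [delta] of the
    scaled [WA (tstar N)]. Its tail at [x] is thus squeezed between Gaussian tails at [x + delta]
    and [x - delta]. *)
Lemma tail_normalized_max (x : R) :
  P [set w | x%:E < normalized_max sigma beta W WA N w]%E @[N --> \oo] -->
  (1 - fine (Phi (x / kappa)))%:E.
Proof.
apply: cvg_EFin; first by apply: nearW => N; exact: fin_num_measure.
apply/cvgrPdist_le => e e0.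
have peak0 : 0 < normal_peak 1 :> R by rewrite normal_peak_gt0// oner_eq0.
(* Chosen so that a shift by [delta] changes [Phi (y / kappa)] by at most [e / 2]. *)
pose delta := kappa * e / (2 * normal_peak 1).
have delta0 : 0 < delta by apply: divr_gt0; exact: mulr_gt0.
have e20 : 0 < e / 2 by rewrite divr_gt0.
have lip (y : R) : fine (Phi ((y + delta) / kappa)) <= fine (Phi (y / kappa)) + e / 2.
  have yd : y / kappa <= (y + delta) / kappa.
    by rewrite ler_pM2r ?invr_gt0// lerDl ltW.
  have := Phi_lipschitz yd.
  rewrite -(fineK (Phi_fin_num ((y + delta) / kappa))) -(fineK (Phi_fin_num (y / kappa))).
  rewrite -EFinD lee_fin.
  rewrite (_ : ((y + delta) / kappa - y / kappa) * normal_peak 1 = e / 2)//.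
  rewrite /delta; field; by rewrite !gt_eqF.
near=> N.
have N1 : (1 < N)%N by near: N; exact: nbhs_infty_gt.
have L0 : 0 < ln N%:R :> R by rewrite ln_gt0// ltr1n.
have l0 : 0 < Num.sqrt (ln N%:R) :> R by rewrite sqrtr_gt0.
have [E [mE PE HE]] : holds_upto P (e / 2) (fun w =>
    ((WA (tstar N) w + sigma ^+ 2 / (2 * beta) * ln N%:R
       - delta * Num.sqrt (ln N%:R))%:E <= max_sup W WA beta N w /\
     max_sup W WA beta N w <= (WA (tstar N) w + sigma ^+ 2 / (2 * beta) * ln N%:R
       + delta * Num.sqrt (ln N%:R))%:E)%E).
  by near: N; exact: (max_sup_approximation sigma_gt0 sigmaA_gt0 beta_gt0 W_bm W_indep WA_bm delta0 e20).
have close w : ~ E w ->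
    (((x + delta) * Num.sqrt (ln N%:R) < WA (tstar N) w ->
       (x%:E < normalized_max sigma beta W WA N w)%E) /\
     ((x%:E < normalized_max sigma beta W WA N w)%E ->
       (x - delta) * Num.sqrt (ln N%:R) < WA (tstar N) w)).
  (* The two bounds also exclude infinite values of the maximum, so the comparison takes place in
     [R]. *)
  move=> /HE; rewrite /normalized_max; case: (max_sup W WA beta N w) => [M| |] [].
  - rewrite !lee_fin => lo up; rewrite lte_fin ltr_pdivlMr//.
    by split => h; nra.
  - by move=> _; rewrite leye_eq.
  - by rewrite leeNy_eq.
have mtail := measurable_tail N x.
have [mu Pu] := WA_tail (x - delta) L0.
have [ml Pl] := WA_tail (x + delta) L0.
have Px := fineK (fin_num_measure P _ mtail).
have up : (P [set w | x%:E < normalized_max sigma beta W WA N w] <=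
    (1 - fine (Phi ((x - delta) / kappa)))%:E + (e / 2)%:E)%E.
  rewrite -Pu; apply: (@le_trans _ _ (P ([set w | (x - delta) * Num.sqrt (ln N%:R)
       < WA (tstar N) w] `|` E))).
    apply: le_measure; rewrite ?inE//; first exact: measurableU.
    by move=> w /= xw; have [?|/close[_ h]] := pselect (E w); [right|left; exact: h].
  by apply: (le_trans (measureU2 _ _ _)) => //; rewrite leeD2l.
have lo : ((1 - fine (Phi ((x + delta) / kappa)))%:E <=
    P [set w | x%:E < normalized_max sigma beta W WA N w] + (e / 2)%:E)%E.
  rewrite -Pl; apply: (@le_trans _ _ (P
      ([set w | (x%:E < normalized_max sigma beta W WA N w)%E] `|` E))).
    apply: le_measure; rewrite ?inE//; first exact: measurableU.
    by move=> w /= xw; have [?|/close[h _]] := pselect (E w); [right|left; exact: h].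
  by apply: (le_trans (measureU2 _ _ _)) => //; rewrite leeD2l.
move: up lo; rewrite -Px -!EFinD !lee_fin => up lo.
have := lip x; have := lip (x - delta); rewrite subrK => lip1 lip2.
by rewrite /= ler_norml; apply/andP; split; lra.
Unshelve. all: by end_near. Qed.

End tail_convergence.

Unset Implicit Arguments.

Theorem theorem5p2 (R : realType) (d : measure_display) (T : measurableType d)
    (P : probability T R) (sigma sigmaA beta : R)
    (W : nat -> R -> {RV P >-> R}) (WA : R -> {RV P >-> R})
    (sigma_gt0 : 0 < sigma) (sigmaA_gt0 : 0 < sigmaA) (beta_gt0 : 0 < beta)
    (W_bm : forall i, brownian_motion (sigma ^+ 2) (W i))
    (W_indep : mutually_independent P (fun i => sigma_process (W i)))
    (WA_bm : brownian_motion (sigmaA ^+ 2) WA)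
    (WA_indep : independent2 P (sigma_process WA)
       (sigma_family [set it : nat * R | 0 <= it.2]
          (fun it : nat * R => W it.1 it.2))) :
  (forall (d' : measure_display) (T' : measurableType d')
      (P' : probability T' R) (X : {RV P' >-> R}),
      has_law P' X (normal_prob 0 1) ->
      cvg_in_distribution P (normalized_max sigma beta W WA)
        P' (fun w => sigma * sigmaA / (Num.sqrt 2 * beta) * X w))
  /\
  (forall x : R,
      P [set w | x%:E < normalized_max sigma beta W WA N w]%E @[N --> \oo] -->
      (1 - Phi (x * Num.sqrt 2 * beta / (sigma * sigmaA)))%E).
Proof.
have tail x := tail_normalized_max sigma_gt0 sigmaA_gt0 beta_gt0 W_bm W_indep WA_bm (x := x).
have mY N : measurable_fun setT (normalized_max sigma beta W WA N).
  by apply: measurable_normalized_max;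
    [move=> i w; exact: bm_continuous (W_bm i) _|move=> w; exact: bm_continuous WA_bm _].
split => [d' T' P' X X_law|x]; last first.
  rewrite (_ : x * Num.sqrt 2 * beta / (sigma * sigmaA) =
    x / (sigma * sigmaA / (Num.sqrt 2 * beta))).
    by have := tail x; rewrite EFinB fineK//; exact: Phi_fin_num.
  by rewrite invf_div !mulrA.
split => // [|x _]; first by apply: measurable_funM => //; exact: measurable_cst.
set kappa := sigma * sigmaA / _ in tail *.
have kappa0 : 0 < kappa by rewrite divr_gt0 ?mulr_gt0 ?sqrtr_gt0.
have -> : P' [set w | kappa * X w <= x] = (fine (Phi (x / kappa)))%:E.
  rewrite fineK ?Phi_fin_num// /Phi -X_law//; congr (P' _).
  by apply/seteqP; split => w /=; rewrite in_itv/= ler_pdivlMr// mulrC.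
(* The distribution functions are complements of the tails, so they converge at every [x]. *)
rewrite (_ : (fine (Phi (x / kappa)))%:E =
  (1%:E - (1 - fine (Phi (x / kappa)))%:E)%E); last by rewrite -EFinB subKr.
rewrite (_ : (fun N => P [set w | (normalized_max sigma beta W WA N w <= x%:E)%E]) =
  (fun N => 1%:E - P [set w | (x%:E < normalized_max sigma beta W WA N w)%E])%E).
  by apply: cvgeB => //; exact: cvg_cst.
apply/funext => N; rewrite -probability_setC; last first.
  rewrite (_ : [set _ | _] = normalized_max sigma beta W WA N @^-1` `]x%:E, +oo[).
    by rewrite -[X in measurable X]setTI; apply: mY => //; exact: emeasurable_itv.
  by apply/seteqP; split => w /=; rewrite in_itv/= andbT.
by congr (P _); apply/seteqP; split => w /=; rewrite leNgt => /negP.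
Qed.
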